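(* Consider the robust heterogeneous vehicle routing problem (HVRP) defined in the context, with uncertainty set $\mathcal{Q}\subseteq\mathbb{R}^n_+$. The feasible solutions $(x,y)$ of the following integer programming formulation are in one-to-one correspondence with the robust feasible solutions of the HVRP: $$\min_{x,y}\ \sum_{k\in K}\ \sum_{i\in V_C:(0,i)\in E}\frac{f_k}{2}\,x_{0ik}+\sum_{k\in K}\sum_{(i,j)\in E}c_{ijk}x_{ijk}$$ subject to - $y_{ik}\in\{0,1\}$ for all $i\in V_C$, $k\in K$; - $x_{ijk}\in\{0,1\}$ for all $(i,j)\in E\cap(V_C\times V_C)$, $k\in K$; - $x_{0ik}\in\{0,1,2\}$ for all $i\in V_C$ with $(0,i)\in E$, $k\in K$; - $\sum_{k\in K}y_{ik}=\sum_{k\in K:\,i\in V_k}y_{ik}=1$ for all $i\in V_C$; - $\sum_{j\in V:(i,j)\in E}x_{ijk}=2y_{ik}$ for all $i\in V_C$, $k\in K$; - $\sum_{i\in V_C:(0,i)\in E}x_{0ik}\le 2m_k$ for all $k\in K$; - $\displaystyle\sum_{(i,j)\in\delta_k(S)}x_{ijk}+2\sum_{i\in S}(1-y_{ik})\ \ge\ 2\left\lceil\frac{1}{Q_k}\max_{q\in\mathcal{Q}}\sum_{i\in S}q_i\right\rceil$ for all $S\subseteq V_k$, $k\in K$. Here $V_k=\{i\in V_C:\max_{q\in\mathcal{Q}}q_i\le Q_k\}$, and for $S\subseteq V_k$, $\delta_k(S)$ is the set of edges in $E$ with one endpoint in $S$ and the other in $(V_k\cup\{0\})\setminus S$. The variable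 $y_{ik}$ records whether customer $i$ is visited by a vehicle of type $k$, and $x_{ijk}$ records whether (for edges at the depot, how many times) the edge $(i,j)$ is traversed by a vehicle of type $k$.
   Context: Let $G=(V,E)$ be an undirected graph with nodes $V=\{0,1,\dots,n\}$; node $0$ is the depot and $V_C=V\setminus\{0\}$ is the set of customers. Edges are undirected, so $(i,j)$ and $(j,i)$ denote the same edge and $x_{ijk}=x_{jik}$. There is a set $K=\{1,\dots,m\}$ of vehicle types; for type $k$ there are $m_k$ vehicles available, each with capacity $Q_k$, fixed cost $f_k\in\mathbb{R}_+$ and routing costs $c_{ijk}\in\mathbb{R}_+$ for $(i,j)\in E$. The uncertainty set $\mathcal{Q}\subseteq\mathbb{R}^n_+$ of customer demand vectors is non-empty, closed and bounded. A route is a simple cycle in $G$ that passes through the depot, represented as $R=(r_1,\dots,r_{|R|})$, where $r_l\in V_C$ is the $l$-th customer visited and $r_0=r_{|R|+1}=0$; a single-customer route traverses the edge $(0,r_1)$ twice. We write $i\in R$ if customer $i$ is visited on $R$. A robust feasible solution of the HVRP is a set of routes $\mathbf{R}=(R_1,\dots,R_H)$ together with a fleet composition vector $\boldsymbol{\kappa}=(\kappa_1,\dots,\kappa_H)$, $\kappa_h\in K$, such that: (i) the routes $R_1,\dots,R_H$ partition $V_C$, i.e. each customer is visited on exactly one route; (ii) for each $k\in K$, the number of $h$ with $\kappa_h=k$ is at most $m_k$; (iii) $\sum_{i\in R_h}q_i\le Q_{\kappa_h}$ for all $h\in\{1,\dots,H\}$ and all $q\in\mathcal{Q}$. Solutions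 that differ only by reordering the pairs $(R_h,\kappa_h)$ or reversing routes are identified. The correspondence associates with a robust feasible solution $(\mathbf{R},\boldsymbol{\kappa})$ the point $(x,y)$ in which $y_{ik}=1$ if customer $i$ lies on a route $R_h$ with $\kappa_h=k$ and $y_{ik}=0$ otherwise, and $x_{ijk}$ is the total number of times the edge $(i,j)$ is traversed by routes $R_h$ with $\kappa_h=k$.
   Formalization: The formal theorem adds that every customer has positive demand for some q in the uncertainty set; otherwise the claim can fail: with zero demands, a customer-only triangle satisfies all constraints but avoids the depot. It also takes each capacity Q_k to be positive. *)

(* Defs.v *)
From mathcomp Require Import all_boot all_order all_algebra.
From mathcomp Require Import boolp classical_sets reals topology normedtype derive.
From mathcomp Require Import archimedean.

Set Implicit Arguments.
Unset Strict Implicit.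
Unset Printing Implicit Defensive.

Import Order.TTheory GRing.Theory Num.Theory.
Import numFieldNormedType.Exports.

Local Open Scope ring_scope.

(* The nodes are 'I_n.+1, with depot 0; the customers are 'I_n, customer i
   being node i.+1, so that demand vectors live in 'rV[R]_n.  An undirected
   edge (i, j) is the two-element set [set i; j]. *)
Definition depot {n : nat} : 'I_n.+1 := ord0.
Definition node {n : nat} (i : 'I_n) : 'I_n.+1 := lift ord0 i.

Record hvrp (R : realType) (n m : nat) := Hvrp {
  edges : {set {set 'I_n.+1}};
  edges_pair : forall e, e \in edges -> #|e| = 2%N;
  fleet : 'I_m -> nat;
  capacity : 'I_m -> R;
  capacity_gt0 : forall k, 0 < capacity k;
  fixed_cost : 'I_m -> R;
  fixed_cost_ge0 : forall k, 0 <= fixed_cost k;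
  routing_cost : {e | e \in edges} -> 'I_m -> R;
  routing_cost_ge0 : forall e k, 0 <= routing_cost e k;
  demands : set 'rV[R]_n;
  demands_nonempty : (demands !=set0)%classic;
  demands_closed : closed demands;
  demands_bounded : bounded_set demands;
  demands_ge0 : forall q, demands q -> forall i, 0 <= q 0 i
}.

Section Hvrp.
Variables (R : realType) (n m : nat) (I : hvrp R n m).

Definition edge : finType := {e | e \in edges I}.

(* For continuous f this supremum is attained: see [max_demand_attained]. *)
Definition max_demand (f : 'rV[R]_n -> R) : R :=
  sup [set f q | q in demands I]%classic.

Lemma max_demand_attained (f : 'rV[R]_n -> R) : continuous f ->
  exists2 q, demands I q &
    f q = max_demand f /\ forall q', demands I q' -> f q' <= f q.
Proof.
move=> fc.
have cQ : compact (demands I).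
  by apply: bounded_closed_compact; [exact: demands_bounded|exact: demands_closed].
have [q Qq qmax] : exists2 q, q \in demands I &
    forall q', q' \in demands I -> f q' <= f q.
  apply: compact_EVT_max => //; first exact: demands_nonempty.
  exact: continuous_subspaceT.
move/set_mem: Qq => Qq.
have ub : forall q', demands I q' -> f q' <= f q by move=> q' /mem_set /qmax.
exists q => //; split => //; apply/eqP; rewrite eq_le; apply/andP; split.
  by apply: ub_le_sup; [exists (f q) => _ [q' /ub ? <-]|exists q].
by apply: ge_sup; [exists (f q), q|move=> _ [q' /ub ? <-]].
Qed.

Definition route_edges (r : seq 'I_n) : seq {set 'I_n.+1} :=
  pairmap (fun u v => [set u; v]) depot (rcons (map node r) depot).

Definition is_route (r : seq 'I_n) : Prop :=
  [/\ r != [::], uniq r & {subset route_edges r <= edges I}].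

(* The list of the pairs (R_h, kappa_h). *)
Definition solution := seq (seq 'I_n * 'I_m).

Record robust_feasible (s : solution) : Prop := RobustFeasible {
  rf_route : forall h, h \in s -> is_route h.1;
  rf_partition : forall i, count (fun h => i \in h.1) s = 1%N;
  rf_fleet : forall k, (count (fun h => h.2 == k) s <= fleet I k)%N;
  rf_capacity : forall h q, h \in s -> demands I q ->
    \sum_(i in h.1) q 0 i <= capacity I h.2
}.

(* Equality up to reordering the pairs and reversing routes. *)
Definition same_solution (s t : solution) : Prop :=
  exists2 u, perm_eq s u &
    all2 (fun h h' => (h'.2 == h.2) && ((h'.1 == h.1) || (h'.1 == rev h.1)))
      u t.

(* p.1 (e, k) is x_{ijk} for the edge e = {i, j}; p.2 (i, k) is y_{ik}. *)
Definition ip_point : Type :=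
  {ffun edge * 'I_m -> R} * {ffun 'I_n * 'I_m -> R}.

Definition cust_fit (k : 'I_m) : {set 'I_n} :=
  [set i | max_demand (fun q => q 0 i) <= capacity I k]%SET.

Definition cut (k : 'I_m) (S : {set 'I_n}) : {set edge} :=
  [set e | [exists i in node @: S,
            exists j in (depot |: node @: cust_fit k) :\: node @: S,
            val e == [set i; j]]]%SET.

(* As edges have two distinct endpoints, a sum over the j with (i, j) in E is
   a sum over the edges containing i. *)
Definition ip_objective (p : ip_point) : R :=
  \sum_k \sum_(e : edge | depot \in val e) fixed_cost I k / 2 * p.1 (e, k)
  + \sum_k \sum_(e : edge) routing_cost e k * p.1 (e, k).

Record ip_constraints (p : ip_point) : Prop := IpConstraints {
  ip_y_binary : forall i k, p.2 (i, k) \in [:: 0; 1];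
  ip_x_customer : forall (e : edge) k, depot \notin val e ->
    p.1 (e, k) \in [:: 0; 1];
  ip_x_depot : forall (e : edge) k, depot \in val e ->
    p.1 (e, k) \in [:: 0; 1; 2];
  ip_assign : forall i,
    \sum_k p.2 (i, k) = \sum_(k | i \in cust_fit k) p.2 (i, k) /\
    \sum_(k | i \in cust_fit k) p.2 (i, k) = 1;
  ip_degree : forall i k,
    \sum_(e : edge | node i \in val e) p.1 (e, k) = 2 * p.2 (i, k);
  ip_fleet : forall k,
    \sum_(e : edge | depot \in val e) p.1 (e, k) <= 2 * (fleet I k)%:R;
  ip_capacity : forall k (S : {set 'I_n}), S \subset cust_fit k ->
    \sum_(e in cut k S) p.1 (e, k) + 2 * \sum_(i in S) (1 - p.2 (i, k)) >=
    2 * (Num.ceil ((capacity I k)^-1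
                   * max_demand (fun q => \sum_(i in S) q 0 i)))%:~R
}.

End Hvrp.

Record min_program (R : realType) (X : Type) := MinProgram {
  objective : X -> R;
  feasible : X -> Prop
}.

Definition hvrp_ip (R : realType) (n m : nat) (I : hvrp R n m) :
    min_program R (ip_point I) :=
  MinProgram (@ip_objective R n m I) (@ip_constraints R n m I).

(* A single-customer route lists its edge twice in [route_edges], hence gives
   x = 2 there. *)
Definition to_point (R : realType) (n m : nat) (I : hvrp R n m)
    (s : solution n m) : ip_point I :=
  ([ffun ek : edge I * 'I_m =>
      (\sum_(h <- s | h.2 == ek.2)
         count_mem (val ek.1) (route_edges h.1))%N%:R],
   [ffun ik : 'I_n * 'I_m =>
      (has (fun h => (ik.1 \in h.1) && (h.2 == ik.2)) s)%:R]).

(* Main.v *)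
(* For a fixed vehicle type k, x(., k) is an edge multigraph in which every
   customer with y_ik = 1 has degree 2 and every other customer degree 0.  By
   positive demand the capacity cuts exclude components avoiding the depot, so
   this multigraph splits, uniquely up to order and orientation, into simple
   cycles through the depot.  The cut inequality for the customer set of one
   such cycle, whose left-hand side is 2, says that the cycle respects the
   capacity in every scenario.  Conversely, the routes of type k that meet S
   leave it at least twice each, and each customer of S served by another type
   contributes a demand of at most Q_k, which gives the cut inequality for S. *)

Require Import Defs.
From mathcomp Require Import all_boot all_order all_algebra.
From mathcomp Require Import boolp classical_sets reals topology normedtype.
From mathcomp Require Import archimedean zify.

Set Implicit Arguments.
Unset Strict Implicit.
Unset Printing Implicit Defensive.

Import Order.TTheory GRing.Theory Num.Theory.
Import numFieldNormedType.Exports.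

(** * Multiplicities and sums over sequences *)

Section Counting.
Local Open Scope nat_scope.

(** By injectivity each entry of [l] comes from a single index [u]. With [f] the inclusion of [edge]
    into the vertex sets, this turns sums over the edge subtype into counts along a route. *)
Lemma sum_count_mem (T : eqType) (U : finType) (f : U -> T) (P : pred T)
    (l : seq T) : injective f -> {subset l <= codom f} ->
  \sum_(u | P (f u)) count_mem (f u) l = count P l.
Proof.
move=> f_inj; elim: l => [|a l IHl] sub /=; first by rewrite big1.
rewrite big_split /= IHl => [|b lb]; last by apply: sub; rewrite inE lb orbT.
congr (_ + _); have /codomP[u ->] : a \in codom f by rewrite sub ?mem_head.
rewrite big_mkcond (bigD1 u) //= eqxx big1 ?addn0; first by case: (P _).
by move=> v neq_vu; rewrite (inj_eq f_inj) eq_sym (negPf neq_vu) if_same.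
Qed.

Lemma sum_count_memT (T : finType) (P : pred T) (l : seq T) :
  \sum_(u | P u) count_mem u l = count P l.
Proof. by apply: (@sum_count_mem _ _ id) => // a _; rewrite codom_f. Qed.

Lemma ltn_sum_strict (T : finType) (P : pred T) (f g : T -> nat) (a : T) :
  (forall b, f b <= g b) -> P a -> f a < g a ->
  \sum_(b | P b) f b < \sum_(b | P b) g b.
Proof.
move=> le_fg Pa lt_fg; rewrite (bigD1 a) // (bigD1 a Pa) /=.
by rewrite -addSn leq_add // leq_sum.
Qed.

Lemma leq_sum_seq (T : eqType) (s : seq T) (P : pred T) (F G : T -> nat) :
  (forall a, a \in s -> P a -> F a <= G a) ->
  \sum_(a <- s | P a) F a <= \sum_(a <- s | P a) G a.
Proof.
move=> le_FG; rewrite (big_seq_cond P F) (big_seq_cond P G).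
by apply: leq_sum => a /andP[]; exact: le_FG.
Qed.

Lemma ler_sum_seq (R : numDomainType) (T : eqType) (s : seq T) (P : pred T)
    (F G : T -> R) :
  (forall a, a \in s -> P a -> (F a <= G a)%R) ->
  (\sum_(a <- s | P a) F a <= \sum_(a <- s | P a) G a)%R.
Proof.
move=> le_FG; rewrite (big_seq_cond P F) (big_seq_cond P G).
by apply: ler_sum => a /andP[]; exact: le_FG.
Qed.

(** Serves for sums over a solution, where [P] singles out the one route through a given
    customer. *)
Lemma sum_single (T : eqType) (s : seq T) (P : pred T) (F : T -> nat) (a : T) :
  count P s = 1 -> a \in s -> P a -> (forall b, ~~ P b -> F b = 0) ->
  \sum_(b <- s) F b = F a.
Proof.
move=> cP sa Pa F0; rewrite (bigID P) /= [X in _ + X]big1 // addn0.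
have: a \in seq.filter P s by rewrite mem_filter Pa sa.
rewrite -big_filter; move: cP; rewrite -size_filter.
case: (seq.filter _ _) => [|b [|]] //= _; rewrite inE => /eqP ->.
by rewrite big_seq1.
Qed.

Lemma count1_mem (T : eqType) (s : seq T) (P : pred T) :
  count P s = 1 ->
  exists a, [/\ a \in s, P a & forall b, b \in s -> P b -> b = a].
Proof.
rewrite -size_filter => c1.
have := mem_filter P ^~ s; move: c1.
case: (seq.filter _ _) => [|a [|]] //= _ H.
exists a; have := H a; rewrite mem_head => /esym/andP[Pa sa].
split => // b sb Pb.
by apply/eqP; have := H b; rewrite inE Pb sb.
Qed.

End Counting.

(** * Walks: degrees, crossings of a vertex set, recovery from edge counts *)

Section Walks.
Local Open Scope nat_scope.
Variable T : finType.
Implicit Types (x y v : T) (p q : seq T) (e : {set T}).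

Definition walk_edges x p : seq {set T} := pairmap (fun u v => [set u; v]) x p.

Lemma walk_edges_cons x y p :
  walk_edges x (y :: p) = [set x; y] :: walk_edges y p.
Proof. by []. Qed.

Lemma walk_edges_rcons x p y :
  walk_edges x (rcons p y) = rcons (walk_edges x p) [set last x p; y].
Proof. by rewrite /walk_edges -!cats1 pairmap_cat. Qed.

Lemma walk_edges_sub x p e v : e \in walk_edges x p -> v \in e -> v \in x :: p.
Proof.
elim: p x => //= y p IHp x; rewrite inE => /orP[/eqP->|pe ve].
  by rewrite !inE => /orP[]->; rewrite ?orbT.
by rewrite inE (IHp y) ?orbT.
Qed.

Lemma walk_edges_rev x p :
  walk_edges (last x p) (rev (belast x p)) = rev (walk_edges x p).
Proof.
elim: p x => //= y p IHp x.
rewrite rev_cons walk_edges_rcons IHp rev_cons; congr (rcons _ _).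
suff -> : last (last y p) (rev (belast y p)) = y.
  by apply/setP=> z; rewrite !inE orbC.
rewrite -[RHS](last_rcons x (rev p)) -rev_cons lastI rev_rcons /=.
by case: (rev _).
Qed.

Lemma path_neq x p : uniq (x :: p) -> path (fun u v => u != v) x p.
Proof.
elim: p x => //= y p IHp x /and3P[].
by rewrite inE negb_or => /andP[-> _] *; apply: IHp; apply/andP.
Qed.

(* Handshake: each visit of v uses two edges, except at the ends of the walk. *)
Lemma walk_degree x p v : path (fun u w => u != w) x p ->
  count (fun e => v \in e) (walk_edges x p) + (v == x) + (v == last x p)
  = 2 * count_mem v (x :: p).
Proof.
elim: p x => [|y p IHp] x /=; first by rewrite (eq_sym x); lia.
case/andP=> neq_xy /IHp /=; rewrite in_set2 !(eq_sym _ v).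
have : ~~ ((v == x) && (v == y)).
  by apply: contra neq_xy => /andP[/eqP <- /eqP <-].
by case: (v == x); case: (v == y) => //=; lia.
Qed.

Lemma open_walk_degree x p v : uniq (x :: p) ->
  count (fun e => v \in e) (walk_edges x p) + (v == x) + (v == last x p)
  = 2 * (v \in x :: p).
Proof.
by move=> uniq_p; rewrite walk_degree ?path_neq // count_uniq_mem.
Qed.

Lemma closed_walk_degree x p v : p != [::] -> uniq (x :: p) ->
  count (fun e => v \in e) (walk_edges x (rcons p x)) = 2 * (v \in x :: p).
Proof.
move=> p0 uniq_p; have := @walk_degree x (rcons p x) v.
rewrite rcons_path path_neq // last_rcons.
have -> : count_mem v (x :: rcons p x) = (v \in x :: p) + (v == x).
  by rewrite -cats1 -cat_cons count_cat count_uniq_mem //= addn0 eq_sym.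
(* The closing edge must not be a loop; this is where [p] has to be nonempty. *)
suff -> : last x p != x by move=> /(_ isT); lia.
case: p p0 uniq_p => // y p _ /andP[xNp _] /=.
by apply: contra xNp => /eqP <-; rewrite mem_last.
Qed.

Lemma walk_edges_uniq x p : uniq (x :: p) -> uniq (walk_edges x p).
Proof.
elim: p x => //= y p IHp x /andP[xNp uniq_p]; rewrite IHp // andbT.
by apply: contra xNp => /walk_edges_sub; apply; rewrite set21.
Qed.

(** [B] limits the edges that have to satisfy [P], because [cut] only counts edges whose outer end
    is the depot or lies in [cust_fit]. *)
Lemma walk_crossing1 (A B : {set T}) (P : pred {set T}) x p :
  {in B &, forall u v, (u \in A) != (v \in A) -> P [set u; v]} ->
  {subset x :: p <= B} -> x \in A -> last x p \notin A ->
  0 < count P (walk_edges x p).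
Proof.
move=> cross; elim: p x => [|y p IHp] x sub Ax /= lastNA.
  by rewrite Ax in lastNA.
have [Bx By] : x \in B /\ y \in B by split; apply: sub; rewrite !inE eqxx ?orbT.
have [Ay|yNA] := boolP (y \in A); last by rewrite cross // Ax (negPf yNA).
rewrite addn_gt0 (IHp y) ?orbT // => z pz.
by apply: sub; rewrite inE pz orbT.
Qed.

(** The first edge into [A] is one crossing; the rest of the walk starts in [A] and ends outside,
    which gives another. The two may be the same edge, counted twice, as on a single-customer
    route. *)
Lemma walk_crossing2 (A B : {set T}) (P : pred {set T}) x p :
  {in B &, forall u v, (u \in A) != (v \in A) -> P [set u; v]} ->
  {subset x :: p <= B} -> x \notin A -> last x p \notin A -> has (mem A) p ->
  1 < count P (walk_edges x p).
Proof.
move=> cross; elim: p x => //= y p IHp x sub xNA lastNA.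
have [Bx By] : x \in B /\ y \in B by split; apply: sub; rewrite !inE eqxx ?orbT.
have sub' : {subset y :: p <= B}.
  by move=> z pz; apply: sub; rewrite inE pz orbT.
have [Ay _|yNA /= hasA] := boolP (y \in A).
  by rewrite cross ?(negPf xNA) ?Ay //= add1n ltnS (walk_crossing1 cross).
by apply: ltn_addl; exact: IHp.
Qed.

(* The edge leaving x is the only one at x on either walk, so the walks leave
   x towards the same vertex; strip that edge and repeat. *)
Lemma walk_eq x p q z :
  uniq (x :: p) -> uniq (x :: q) -> last x p = z -> last x q = z ->
  (forall v e, v != z -> v \in x :: p -> v \in x :: q -> v \in e ->
     count_mem e (walk_edges x p) = count_mem e (walk_edges x q)) ->
  p = q.
Proof.
elim: p x q => [|y p IHp] x [|y' q] //=.
- by move=> _ /andP[xNq _] lx lq; rewrite lx -lq mem_last in xNq.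
- by move=> /andP[xNp _] _ lp eq_xz; rewrite eq_xz -lp mem_last in xNp.
move=> /andP[xNp uniq_p] /andP[xNq uniq_q] lp lq eq_count.
have neq_xz : x != z by apply: contra xNp => /eqP->; rewrite -lp mem_last.
have eq_y : y = y'.
  have := eq_count x _ neq_xz (mem_head _ _) (mem_head _ _) (set21 x y).
  have /count_memPn -> : [set x; y] \notin walk_edges y' q.
    by apply: contra xNq => /walk_edges_sub; apply; rewrite set21.
  rewrite eqxx; case: eqP => // eq_e _.
  have : y \in [set x; y'] by rewrite eq_e set22.
  rewrite in_set2 => /orP[/eqP eq_yx|/eqP //].
  by rewrite eq_yx mem_head in xNp.
move: eq_y uniq_q xNq lq eq_count => <- uniq_q xNq lq eq_count.
congr (_ :: _); apply: (IHp y) => // v e vz vp vq ve; apply/eqP.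
rewrite -(eqn_add2l ([set x; y] == e)); apply/eqP.
by apply: (eq_count v) => //; rewrite inE ?vp ?vq orbT.
Qed.

End Walks.

(** * Routes as closed walks through the depot *)

Section Routes.
Local Open Scope nat_scope.
Variable n : nat.
Implicit Types (i j : 'I_n) (r : seq 'I_n) (e : {set 'I_n.+1}).

Lemma node_inj : injective (@node n).
Proof. exact: lift_inj. Qed.

Lemma node_neq_depot i : node i != depot.
Proof. by rewrite eq_sym neq_lift. Qed.

Lemma depot_notin_nodes (S : {pred 'I_n}) : depot \notin node @: S.
Proof.
by apply/imsetP => -[i _] /eqP; rewrite eq_sym (negPf (node_neq_depot i)).
Qed.

Lemma node_or_depot (u : 'I_n.+1) : u = depot \/ exists i, u = node i.
Proof. by case: (unliftP ord0 u) => [i ->|->]; [right; exists i|left]. Qed.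

Lemma node_walk_uniq r : uniq (depot :: map node r) = uniq r.
Proof.
rewrite /= (map_inj_uniq node_inj) andb_idl // => _.
by apply/mapP => -[i _] /eqP; rewrite eq_sym (negPf (node_neq_depot i)).
Qed.

Lemma mem_route_nodes i r : (node i \in depot :: map node r) = (i \in r).
Proof. by rewrite inE (negPf (node_neq_depot i)) (mem_map node_inj). Qed.

Lemma route_edges_walk r :
  route_edges r = walk_edges depot (rcons (map node r) depot).
Proof. by []. Qed.

Lemma route_edges_rcons r :
  route_edges r
  = rcons (walk_edges depot (map node r)) [set last depot (map node r); depot].
Proof. by rewrite route_edges_walk walk_edges_rcons. Qed.

Lemma route_degree r i : r != [::] -> uniq r ->
  count (fun e => node i \in e) (route_edges r) = 2 * (i \in r).
Proof.
move=> r0 uniq_r.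
rewrite route_edges_walk closed_walk_degree ?node_walk_uniq //.
  by rewrite mem_route_nodes.
by case: (r) r0.
Qed.

Lemma depot_degree r : r != [::] -> uniq r ->
  count (fun e => depot \in e) (route_edges r) = 2.
Proof.
move=> r0 uniq_r.
rewrite route_edges_walk closed_walk_degree ?node_walk_uniq //.
by case: (r) r0.
Qed.

Lemma route_edges_sub r e v :
  e \in route_edges r -> v \in e -> v \in depot :: map node r.
Proof.
move=> re ve; have := walk_edges_sub re ve.
by rewrite inE mem_rcons inE orbA orbb.
Qed.

Lemma count_route_edges0 r e i :
  node i \in e -> i \notin r -> count_mem e (route_edges r) = 0.
Proof.
move=> ie iNr; apply/count_memPn; apply: contra iNr => re.
by rewrite -mem_route_nodes (route_edges_sub re).
Qed.

(** Without its closing edge the walk repeats no edge, and the closing edge contains the depot. *)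
Lemma customer_edge_le1 r e : uniq r -> depot \notin e ->
  count_mem e (route_edges r) <= 1.
Proof.
move=> uniq_r eN0; rewrite route_edges_rcons -cats1 count_cat /=.
rewrite count_uniq_mem ?walk_edges_uniq ?node_walk_uniq //.
case: eqP eN0 => [<-|_]; first by rewrite set22.
by rewrite !addn0 leq_b1.
Qed.

Lemma route_edges_rev r : perm_eq (route_edges (rev r)) (route_edges r).
Proof.
have := walk_edges_rev depot (rcons (map node r) depot).
rewrite last_rcons belast_rcons rev_cons -map_rev -!route_edges_walk => ->.
by rewrite perm_rev.
Qed.

Lemma route_crossing r (S : {pred 'I_n}) (B : {set 'I_n.+1})
    (P : pred {set 'I_n.+1}) :
  {in B &, forall u v,
     (u \in node @: S) != (v \in node @: S) -> P [set u; v]} ->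
  {subset depot :: map node r <= B} -> has S r ->
  1 < count P (route_edges r).
Proof.
move=> cross sub /hasP[i ri Si].
apply: (walk_crossing2 (A := node @: S) cross).
- by move=> v; rewrite inE mem_rcons inE orbA orbb -in_cons => /sub.
- exact: depot_notin_nodes.
- by rewrite last_rcons depot_notin_nodes.
- apply/hasP; exists (node i); last exact: imset_f.
  by rewrite mem_rcons inE map_f ?orbT.
Qed.

(** Cancelling the common first edge from the depot to [i] leaves two simple walks from [i] to the
    depot, to which [walk_eq] applies. *)
Lemma routes_eq_head i p q :
  uniq (i :: p) -> uniq (i :: q) ->
  (forall j e, j \in i :: p -> j \in i :: q -> node j \in e ->
     count_mem e (route_edges (i :: p)) = count_mem e (route_edges (i :: q))) ->
  p = q.
Proof.
have suffix_uniq l : uniq (i :: l) -> uniq (node i :: rcons (map node l) depot).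
  move=> uniq_l; rewrite -rcons_cons -map_cons rcons_uniq.
  by have := node_walk_uniq (i :: l); rewrite cons_uniq uniq_l.
have suffix_mem j l :
    (node j \in node i :: rcons (map node l) depot) = (j \in i :: l).
  rewrite -rcons_cons -map_cons mem_rcons inE (negPf (node_neq_depot j)) /=.
  by rewrite -map_cons (mem_map node_inj).
move=> uniq_p uniq_q eq_count; apply: (inj_map node_inj).
suff : rcons (map node p) depot = rcons (map node q) depot by case/rcons_inj.
apply: (@walk_eq _ (node i) _ _ depot); rewrite ?last_rcons ?suffix_uniq //.
move=> v e v0; have [v_eq|[j ->]] := node_or_depot v.
  by rewrite v_eq eqxx in v0.
rewrite !suffix_mem => jp jq je; apply/eqP.
rewrite -(eqn_add2l ([set depot; node i] == e)); apply/eqP.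
exact: (eq_count j).
Qed.

(** The edge joining the depot to [i] lies on [t], so [i] is the first or the last customer of [t];
    in the second case [t] is reversed. Counts are compared only at shared customers, since only
    there does a point (x, y) determine the counts of an individual route. *)
Lemma routes_eq i r t :
  uniq (i :: r) -> uniq t -> i \in t ->
  (forall j e, j \in i :: r -> j \in t -> node j \in e ->
     count_mem e (route_edges (i :: r)) = count_mem e (route_edges t)) ->
  t = i :: r \/ t = rev (i :: r).
Proof.
move=> uniq_r uniq_t ti eq_count.
have : [set depot; node i] \in route_edges t.
  rewrite -has_pred1 has_count -(eq_count i) ?mem_head ?set22 //.
  by rewrite -has_count has_pred1 mem_head.
have eq_rev : forall j e, j \in i :: r -> j \in rev t -> node j \in e ->
    count_mem e (route_edges (i :: r)) = count_mem e (route_edges (rev t)).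
  move=> j e jr; rewrite mem_rev => jt je; rewrite (eq_count j) //.
  by apply/esym/permP/route_edges_rev.
case: t ti uniq_t eq_count eq_rev => // j t _ uniq_t eq_count eq_rev.
rewrite route_edges_rcons mem_rcons inE.
rewrite [in X in _ || X]map_cons walk_edges_cons inE.
case/or3P=> [/eqP eq_e|/eqP eq_e|].
- have : node i \in [set last depot (map node (j :: t)); depot].
    by rewrite -eq_e set22.
  rewrite in_set2 (negPf (node_neq_depot i)) orbF /= last_map (inj_eq node_inj).
  move/eqP=> eq_i; right; move: uniq_t eq_rev; rewrite -rev_uniq.
  rewrite lastI rev_rcons -eq_i => uniq_t eq_rev.
  by rewrite (routes_eq_head uniq_r uniq_t eq_rev) rev_cons revK.
- have : node i \in [set depot; node j] by rewrite -eq_e set22.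
  rewrite in_set2 (negPf (node_neq_depot i)) (inj_eq node_inj) => /eqP eq_ij.
  rewrite -eq_ij in uniq_t eq_count *.
  by left; rewrite (routes_eq_head uniq_r uniq_t eq_count).
(* Neither the first nor the closing edge: then the depot would be a customer of the route. *)
- move/walk_edges_sub/(_ (set21 _ _)) => /= t0.
  by have := node_walk_uniq (j :: t); rewrite uniq_t cons_uniq t0.
Qed.

End Routes.
Arguments node_inj {n}.

(** * Splitting a multigraph of customer degrees 0 and 2 into routes *)

Section Decomposition.
Local Open Scope nat_scope.
Variable n : nat.
Implicit Types (i j : 'I_n) (r : seq 'I_n) (e : {set 'I_n.+1}).
Implicit Types (w : {set 'I_n.+1} -> nat) (W S : {set 'I_n}).

Lemma other_endpoint (T : finType) (e : {set T}) v :
  #|e| = 2 -> v \in e -> exists2 u, u != v & e = [set v; u].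
Proof.
move/eqP/cards2P=> [x [y [neq_xy ->]]]; rewrite in_set2 => /orP[]/eqP->.
  by exists y; rewrite // eq_sym.
by exists x; rewrite // finset.setUC.
Qed.

(* Extend the open path greedily.  Its last node has degree 2 in w and degree 1
   on the path, so an unused edge leaves it; that edge cannot lead back to a
   node of the path, whose degree is already exhausted. *)
Lemma open_route_closes w W k r :
  (forall e, 0 < w e -> #|e| = 2) ->
  (forall i, \sum_(e : {set 'I_n.+1} | node i \in e) w e = 2 * (i \in W)) ->
  n < size r + k -> r != [::] -> uniq r ->
  (forall e, count_mem e (walk_edges depot (map node r)) <= w e) ->
  exists t, [/\ t != [::], uniq t
              & forall e, count_mem e (route_edges t) <= w e].
Proof.
move=> w2 wdeg; elim: k r => [|k IHk] r size_r r0 uniq_r le_w.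
  (* [k] is fuel: once it is used up, [r] would list more than [n] distinct customers. *)
  have := max_card [in r]; rewrite card_ord (card_uniqP uniq_r) => le_r.
  by rewrite addn0 ltnNge le_r in size_r.
have [v last_v] : exists v, last depot (map node r) = node v.
  by case: (r) r0 => // i l _; exists (last i l); rewrite /= last_map.
have path_deg j :
    \sum_(e : {set 'I_n.+1} | node j \in e)
       count_mem e (walk_edges depot (map node r))
    = 2 * (j \in r) - (j == v).
  have := @open_walk_degree _ depot (map node r) (node j).
  rewrite node_walk_uniq => /(_ uniq_r).
  rewrite mem_route_nodes last_v (negPf (node_neq_depot j)) (inj_eq node_inj).
  by rewrite sum_count_memT => <-; rewrite addn0 addnK.
have rv : v \in r.
  by rewrite -mem_route_nodes -last_v mem_last.
have le_deg j : 2 * (j \in r) - (j == v) <= 2 * (j \in W).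
  by rewrite -path_deg -wdeg leq_sum.
have [e ve lt_e] : exists2 e : {set 'I_n.+1},
    node v \in e & count_mem e (walk_edges depot (map node r)) < w e.
  have /existsP[e /andP[ve lt_e]] : [exists e : {set 'I_n.+1}, (node v \in e) &&
      (count_mem e (walk_edges depot (map node r)) < w e)]; last by exists e.
  apply: contraT => /existsPn no_e.
  have : \sum_(e : {set 'I_n.+1} | node v \in e) w e
      <= 2 * (v \in r) - (v == v).
    rewrite -path_deg leq_sum // => e ve.
    by have := no_e e; rewrite ve /= -leqNgt.
  by rewrite wdeg; have := le_deg v; rewrite rv eqxx; case: (v \in W).
have [u neq_uv e_uv] := other_endpoint (w2 e (leq_ltn_trans (leq0n _) lt_e)) ve.
have le_w' e' :
    count_mem e' (rcons (walk_edges depot (map node r)) [set node v; u])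
    <= w e'.
  rewrite -cats1 count_cat /= addn0 -e_uv.
  by have [<-|_] := eqVneq e e'; rewrite ?addn1 ?addn0.
have [u0|[j u_j]] := node_or_depot u.
  exists r; split=> // e'; rewrite route_edges_walk walk_edges_rcons last_v.
  by have := le_w' e'; rewrite u0.
have neq_jv : j != v by rewrite -(inj_eq node_inj) -u_j.
have jNr : j \notin r.
  apply/negP => rj; have je : node j \in e by rewrite e_uv u_j set22.
  have := @ltn_sum_strict _ (fun e : {set 'I_n.+1} => node j \in e) _ _ e
    le_w je lt_e.
  by rewrite path_deg wdeg rj (negPf neq_jv); case: (j \in W).
apply: (IHk (rcons r j)).
- by rewrite size_rcons addSnnS.
- by case: (r).
- by rewrite rcons_uniq jNr.
- by move=> e'; rewrite map_rcons walk_edges_rcons last_v -u_j le_w'.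
Qed.

Lemma route_exists w W :
  (forall e, 0 < w e -> #|e| = 2) ->
  (forall i, \sum_(e : {set 'I_n.+1} | node i \in e) w e = 2 * (i \in W)) ->
  (exists i, 0 < w [set depot; node i]) ->
  exists t, [/\ t != [::], uniq t
              & forall e, count_mem e (route_edges t) <= w e].
Proof.
move=> w2 wdeg [i wi]; apply: (@open_route_closes w W n [:: i]) => // e.
by rewrite /= addn0; case: eqP => // <-.
Qed.

Lemma degree_support w W e i :
  (forall i, \sum_(e : {set 'I_n.+1} | node i \in e) w e = 2 * (i \in W)) ->
  0 < w e -> node i \in e -> i \in W.
Proof.
move=> wdeg we ie; apply: contraLR we => /negPf iNW.
have /eqP := wdeg i; rewrite iNW sum_nat_eq0 => /forall_inP/(_ _ ie)/eqP->.
by [].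
Qed.

(** Induction on the size of [W]. The cut condition for [W] itself yields an edge leaving [W]; its
    outer end is the depot, since customers on edges of positive weight lie in [W]. Such an edge
    starts a route, which is subtracted from [w] and its customers from [W]. *)
Lemma route_decomposition w W :
  (forall e, 0 < w e -> #|e| = 2) ->
  (forall i, \sum_(e : {set 'I_n.+1} | node i \in e) w e = 2 * (i \in W)) ->
  (forall S, S \subset W -> S != finset.set0 -> exists u v,
     [/\ u \in node @: S, v \notin node @: S & 0 < w [set u; v]]) ->
  exists2 rs : seq (seq 'I_n), all (fun r => (r != [::]) && uniq r) rs &
    forall e, w e = \sum_(r <- rs) count_mem e (route_edges r).
Proof.
have [k le_W] := ubnP #|W|; elim: k => // k IHk in w W le_W *.
move=> w2 wdeg wcut; have [W0|W_neq0] := eqVneq W finset.set0.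
  exists [::] => // e; rewrite big_nil; apply/eqP; rewrite -leqn0 leqNgt.
  apply/negP => we; have /eqP/cards2P[x [y [neq_xy e_xy]]] := w2 e we.
  have [i ie] : exists i, node i \in e.
    have [x0|[i x_i]] := node_or_depot x.
      have [y0|[i y_i]] := node_or_depot y.
        by rewrite x0 y0 eqxx in neq_xy.
      by exists i; rewrite e_xy y_i set22.
    by exists i; rewrite e_xy x_i set21.
  by have := degree_support wdeg we ie; rewrite W0 inE.
have [_ [v [/imsetP[i Wi ->] vNW wiv]]] := wcut W (subxx _) W_neq0.
have v0 : v = depot.
  have [//|[j v_j]] := node_or_depot v; case/negP: vNW; rewrite v_j imset_f //.
  by apply: (degree_support wdeg wiv); rewrite v_j set22.
have [|r [r0 uniq_r le_w]] := route_exists w2 wdeg.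
  by exists i; rewrite finset.setUC -v0.
have le_rW j : (j \in r) <= (j \in W).
  have : \sum_(e : {set 'I_n.+1} | node j \in e) count_mem e (route_edges r)
      <= 2 * (j \in W) by rewrite -wdeg leq_sum.
  by rewrite sum_count_memT route_degree // leq_pmul2l.
pose w' e := w e - count_mem e (route_edges r).
have wE e : w e = w' e + count_mem e (route_edges r) by rewrite subnK.
have [||||rs rs_ok w'E] := IHk w' (W :\: [set j in r]).
- rewrite ltnS in le_W; apply: leq_trans le_W; apply: proper_card.
  apply/properP; split; first exact: subsetDl.
  case: (r) r0 le_rW => // j l _ /(_ j); rewrite mem_head lt0b => Wj.
  by exists j; rewrite // !inE eqxx.
- by move=> e w'e; apply: w2; rewrite wE ltn_addr.
- move=> j; rewrite sumnB => [|e _]; last exact: le_w.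
  rewrite wdeg sum_count_memT route_degree // !inE.
  by have := le_rW j; case: (j \in r); case: (j \in W).
- move=> S; rewrite subsetD => /andP[SW disj] S0.
  have [_ [v' [/imsetP[j Sj ->] v'NS wjv]]] := wcut S SW S0.
  exists (node j), v'; split=> //; first exact: imset_f.
  (* The crossing edge survives the subtraction: it contains [j], which is not on [r]. *)
  rewrite /w' (count_route_edges0 (set21 _ _)) ?subn0 //.
  by have := disjointFr disj Sj; rewrite inE => ->.
exists (r :: rs); first by rewrite /= r0 uniq_r.
by move=> e; rewrite big_cons -w'E wE addnC.
Qed.

End Decomposition.

(** * From robust feasible solutions to feasible integer points *)

Section Solutions.
Local Open Scope ring_scope.
Variables (R : realType) (n m : nat) (I : hvrp R n m).
Implicit Types (s t : solution n m) (S : {set 'I_n}) (A : {set 'I_n.+1}).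

Lemma demand_sum_continuous S :
  continuous (fun q : 'rV[R]_n => \sum_(i in S) q 0 i).
Proof.
apply: (@continuous_big R _ +%R 0 _ _ 'rV[R]_n _ (fun i q => q 0 i)) => [|i _].
  exact: add_continuous.
exact: coord_continuous.
Qed.

(** Continuity on the compact demand set makes [sup] a true upper bound rather than a default
    value. *)
Lemma le_max_demand (f : 'rV[R]_n -> R) q :
  continuous f -> demands I q -> f q <= max_demand I f.
Proof. by move=> /(max_demand_attained I)[q' _ [<- le_f]] /le_f. Qed.

Lemma max_demand_le (f : 'rV[R]_n -> R) c :
  (forall q, demands I q -> f q <= c) -> max_demand I f <= c.
Proof.
move=> le_c; apply: ge_sup; last by move=> _ [q /le_c le_fq <-].
by have [q Iq] := demands_nonempty I; exists (f q), q.
Qed.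

Lemma cust_fitP i k :
  (forall q, demands I q -> q 0 i <= capacity I k) <-> i \in cust_fit I k.
Proof.
rewrite inE; split=> [|le_cap q Iq]; first exact: max_demand_le.
apply: le_trans le_cap; apply: (@le_max_demand (fun q => q 0 i)) => //.
exact: coord_continuous.
Qed.

Lemma sum_edge (V : nmodType) (P : pred {set 'I_n.+1})
    (F : {set 'I_n.+1} -> V) :
  (forall A, A \notin edges I -> F A = 0) ->
  \sum_(A | P A) F A = \sum_(e : edge I | P (val e)) F (val e).
Proof.
move=> F0; rewrite -(big_sub_cond (edges I) P F).
rewrite [LHS](bigID (mem (edges I))) /=.
rewrite [X in _ + X]big1 => [|A /andP[_]]; last exact: F0.
by rewrite addr0; apply: eq_bigl => A; rewrite andbC.
Qed.

(* [cut I k S] is a set of elements of a subtype; this is its image. *)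
Definition crosses k S (A : {set 'I_n.+1}) : bool :=
  [exists u in node @: S,
   exists v in (depot |: node @: cust_fit I k) :\: node @: S, A == [set u; v]].

Lemma mem_cut k S (e : edge I) : (e \in cut I k S) = crosses k S (val e).
Proof. by rewrite inE. Qed.

Lemma crossesP k S A :
  reflect (exists i v, [/\ i \in S, v \notin node @: S,
             v \in depot |: node @: cust_fit I k & A = [set node i; v]])
          (crosses k S A).
Proof.
apply: (iffP exists_inP) => [[u /imsetP[i Si ->] /exists_inP[v]]|].
  by rewrite finset.in_setD => /andP[vNS fit_v] /eqP ->; exists i, v.
move=> [i [v [Si vNS fit_v ->]]]; exists (node i); first exact: imset_f.
by apply/exists_inP; exists v; rewrite // finset.in_setD vNS.
Qed.

(** The natural number behind x, defined on all vertex sets so that no proof of membership in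
    [edges] is carried along. *)
Definition traversals s k (A : {set 'I_n.+1}) : nat :=
  \sum_(h <- s | h.2 == k) count_mem A (route_edges h.1).

Lemma to_point_x s e k : (to_point I s).1 (e, k) = (traversals s k (val e))%:R.
Proof. by rewrite ffunE. Qed.

Lemma to_point_y s i k :
  (to_point I s).2 (i, k) = (has (fun h => (i \in h.1) && (h.2 == k)) s)%:R.
Proof. by rewrite ffunE. Qed.

Section Feasible.
Variables (s : solution n m) (fs : robust_feasible I s).

Lemma route_of i :
  exists h, [/\ h \in s, i \in h.1
              & forall h', h' \in s -> i \in h'.1 -> h' = h].
Proof. exact: (count1_mem (rf_partition fs i)). Qed.

Lemma route_unique h h' i :
  h \in s -> h' \in s -> i \in h.1 -> i \in h'.1 -> h = h'.
Proof.
have [h0 [_ _ uniq_h]] := route_of i.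
by move=> sh sh' /(uniq_h _ sh) -> /(uniq_h _ sh') ->.
Qed.

(** The routes partition the customers, so the number of routes of type [k] through [i] is 0 or 1
    and agrees with the truth value in [to_point]. *)
Lemma to_point_y_sum i k :
  (to_point I s).2 (i, k) = (\sum_(h <- s | h.2 == k) (i \in h.1))%N%:R.
Proof.
rewrite to_point_y; congr _%:R; have [h [sh ih uniq_h]] := route_of i.
rewrite big_mkcond (@sum_single _ s _ _ h (rf_partition fs i)) //=; last first.
  by move=> h' /negPf ->; rewrite if_same.
rewrite ih; case: ifP => [hk|hNk].
  by apply/eqP; rewrite eqb1; apply/hasP; exists h; rewrite // ih.
apply/eqP; rewrite eqb0; apply/hasPn => h' sh'; apply/negP => /andP[ih' hk].
by rewrite (uniq_h h' sh' ih') hNk in hk.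
Qed.

Lemma to_point_y_route h i k : h \in s -> i \in h.1 ->
  (to_point I s).2 (i, k) = (h.2 == k)%:R.
Proof.
move=> sh ih; rewrite to_point_y_sum big_mkcond.
rewrite (@sum_single _ s _ _ h (rf_partition fs i)) //=; last first.
  by move=> h' /negPf ->; rewrite if_same.
by rewrite ih; case: ifP.
Qed.

(** An edge at [i] can only be used by the unique route through [i]. *)
Lemma traversals_route h i k (A : {set 'I_n.+1}) :
  h \in s -> i \in h.1 -> node i \in A ->
  traversals s k A = if h.2 == k then count_mem A (route_edges h.1) else 0%N.
Proof.
move=> sh ih iA; rewrite /traversals big_mkcond /=.
rewrite (@sum_single _ s _ _ h (rf_partition fs i)) // => h' ih'.
by rewrite (count_route_edges0 iA ih') if_same.
Qed.

Lemma sum_route_edges h (P : pred {set 'I_n.+1}) : h \in s ->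
  (\sum_(e : edge I | P (val e)) count_mem (val e) (route_edges h.1)
   = count P (route_edges h.1))%N.
Proof.
move=> sh; apply: sum_count_mem; first exact: val_inj.
have [_ _ sub] := rf_route fs sh; move=> A /sub EA.
by apply/codomP; exists (exist _ A EA).
Qed.

Lemma sum_to_point_x (P : pred {set 'I_n.+1}) k :
  \sum_(e : edge I | P (val e)) (to_point I s).1 (e, k)
  = (\sum_(h <- s | h.2 == k) count P (route_edges h.1))%N%:R.
Proof.
rewrite (eq_bigr _ (fun e _ => to_point_x s e k)) -natr_sum exchange_big /=.
congr _%:R; rewrite big_seq_cond [RHS]big_seq_cond.
by apply: eq_bigr => h /andP[sh _]; rewrite sum_route_edges.
Qed.

(** Demands are nonnegative, so a single customer demands at most the load of its route. *)
Lemma route_fits h : h \in s -> {subset h.1 <= cust_fit I h.2}.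
Proof.
move=> sh i ih; apply/cust_fitP => q Iq.
apply: le_trans (rf_capacity fs sh Iq); rewrite (bigD1 i) //= lerDl.
by apply: sumr_ge0 => j _; apply: demands_ge0 Iq j.
Qed.

(** A route starts and ends at the depot, outside [S]. By [route_fits] its customers lie in
    [cust_fit], so every edge on which it enters or leaves [S] is one that [cut] counts. *)
Lemma routes_meeting_le_crossings k S :
  (2 * \sum_(h <- s | h.2 == k) has (mem S) h.1
   <= \sum_(h <- s | h.2 == k) count (crosses k S) (route_edges h.1))%N.
Proof.
rewrite big_distrr /=; apply: leq_sum_seq => h sh /eqP hk.
have [meet|//] := boolP (has (mem S) h.1); rewrite muln1.
apply: (@route_crossing _ _ (mem S) (depot |: node @: cust_fit I k)) => //.
  move=> u v Bu Bv.
  have [/imsetP[i Si u_i]|uNS] := boolP (u \in _).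
    case: (boolP (v \in _)) => // vNS _.
    by apply/crossesP; exists i, v; rewrite u_i.
  case: (boolP (v \in _)) => // /imsetP[i Si v_i] _.
  by apply/crossesP; exists i, u; split=> //; rewrite v_i finset.setUC.
move=> u; rewrite inE => /orP[/eqP ->|/mapP[i ih ->]].
  exact: finset.setU11.
by apply/finset.setU1P; right; apply: imset_f; rewrite -hk route_fits.
Qed.

Lemma demand_le_routes k S q : S \subset cust_fit I k -> demands I q ->
  \sum_(i in S) q 0 i
  <= (\sum_(h <- s | h.2 == k) has (mem S) h.1)%N%:R * capacity I k
     + \sum_(i in S) (1 - (to_point I s).2 (i, k)) * capacity I k.
Proof.
move=> /fintype.subsetP fitS Iq; have q0 i := demands_ge0 Iq i.
(* Termwise, a customer served by type [k] keeps its demand and any other is charged a full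
   capacity. Exchanging sums then groups the kept demands by route. *)
apply: (@le_trans _ _ (\sum_(i in S)
    (\sum_(h <- s | h.2 == k) (i \in h.1)%:R * q 0 i
     + (1 - (to_point I s).2 (i, k)) * capacity I k))).
  apply: ler_sum => i Si.
  rewrite -mulr_suml -natr_sum -to_point_y_sum to_point_y.
  have := (cust_fitP i k).2 (fitS i Si) q Iq.
  by case: (has _ _); rewrite /= ?subrr ?subr0 !mul1r !mul0r ?addr0 ?add0r.
rewrite big_split /= lerD2r exchange_big natr_sum mulr_suml /=.
apply: ler_sum_seq => h sh /eqP hk.
have [_|noS] := boolP (has (mem S) h.1).
  rewrite mul1r -hk; apply: le_trans (rf_capacity fs sh Iq).
  rewrite [leRHS]big_mkcond [leLHS]big_mkcond /=; apply: ler_sum => i _.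
  by case: (i \in S); case: (i \in h.1); rewrite ?mul1r ?mul0r ?q0.
rewrite mul0r big1 // => i Si.
suff /negPf -> : i \notin h.1 by rewrite mul0r.
by apply: contra noS => ih; apply/hasP; exists i.
Qed.

Lemma to_point_feasible : ip_constraints (to_point I s).
Proof.
split=> [i k|e k eN0|e k e0|i|i k|k|k S fitS].
- by rewrite to_point_y !inE; case: has; rewrite eqxx ?orbT.
- have /eqP/cards2P[x [y [_ e_xy]]] := edges_pair (valP e).
  have [x0|[i x_i]] := node_or_depot x; first by rewrite e_xy x0 set21 in eN0.
  have ie : node i \in val e by rewrite e_xy x_i set21.
  have [h [sh ih _]] := route_of i; have [_ uniq_h _] := rf_route fs sh.
  rewrite to_point_x (traversals_route k sh ih ie).
  case: ifP => _; last by rewrite inE eqxx.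
  have := customer_edge_le1 uniq_h eN0.
  by case: count => [|[|//]] _; rewrite !inE eqxx ?orbT.
- have /(other_endpoint (edges_pair (valP e)))[u u0 e_u] := e0.
  have [/eqP|[i u_i]] := node_or_depot u; first by rewrite (negPf u0).
  have ie : node i \in val e by rewrite e_u u_i set22.
  have [h [sh ih _]] := route_of i; have [h0 uniq_h _] := rf_route fs sh.
  rewrite to_point_x (traversals_route k sh ih ie).
  case: ifP => _; last by rewrite inE eqxx.
  (* The edge occurs at most as often as the degree of [i] on its route, which is 2. *)
  have : (count_mem (val e) (route_edges h.1) <= 2)%N.
    rewrite -[leqRHS]/(2 * true)%N -ih -(route_degree i h0 uniq_h).
    by apply: sub_count => A /eqP ->.
  by case: count => [|[|[|//]]] _; rewrite !inE eqxx ?orbT.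
- have [h [sh ih _]] := route_of i.
  have y_h k : (to_point I s).2 (i, k) = (h.2 == k)%:R.
    exact: to_point_y_route.
  have fit_h := route_fits sh ih.
  have sum1 : \sum_(k | i \in cust_fit I k) (to_point I s).2 (i, k) = 1.
    rewrite (bigD1 h.2) //= y_h eqxx big1 ?addr0 // => k /andP[_ neq_k].
    by rewrite y_h eq_sym (negPf neq_k).
  split=> //; rewrite sum1 (bigD1 h.2) //= y_h eqxx big1 ?addr0 // => k neq_k.
  by rewrite y_h eq_sym (negPf neq_k).
- rewrite (sum_to_point_x (fun A => node i \in A)) to_point_y_sum.
  rewrite -(natrM _ 2) big_distrr /=; congr _%:R.
  rewrite big_seq_cond [RHS]big_seq_cond; apply: eq_bigr => h /andP[sh _].
  by have [h0 uniq_h _] := rf_route fs sh; rewrite route_degree.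
- rewrite (sum_to_point_x (fun A => depot \in A)) -(natrM _ 2) ler_nat.
  rewrite big_seq_cond.
  rewrite (eq_bigr (fun=> 2 * 1)%N) => [|h /andP[sh _]]; last first.
    by have [h0 uniq_h _] := rf_route fs sh; rewrite depot_degree.
  by rewrite -big_seq_cond -big_distrr sum1_count leq_mul2l (rf_fleet fs).
- rewrite (eq_bigl _ _ (mem_cut k S)) sum_to_point_x.
  set N := (\sum_(h <- s | h.2 == k) has (mem S) h.1)%N.
  set M := (\sum_(i in S) ~~ has (fun h => (i \in h.1) && (h.2 == k)) s)%N.
  have ME : \sum_(i in S) (1 - (to_point I s).2 (i, k)) = M%:R.
    rewrite natr_sum; apply: eq_bigr => i _; rewrite to_point_y.
    by case: has; rewrite ?subrr ?subr0.
  (* [N] counts the routes of type [k] meeting [S], [M] the customers of [S] served by other types.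
     As [N + M] is an integer, bounding the quotient also bounds its ceiling. *)
  have ceil_le : Num.ceil ((capacity I k)^-1
      * max_demand I (fun q => \sum_(i in S) q 0 i)) <= (N + M)%:Z.
    rewrite ceil_le_int ler_pdivrMl ?capacity_gt0 //.
    apply: max_demand_le => q Iq; apply: le_trans (demand_le_routes fitS Iq) _.
    by rewrite -mulr_suml ME -mulrDl -natrD mulrC.
  apply: (@le_trans _ _ (2 * (N + M)%:R)).
    by rewrite ler_pM2l // -[(N + M)%:R]/((N + M)%:Z%:~R) ler_int.
  rewrite ME natrD mulrDr lerD2r -(natrM _ 2) ler_nat.
  exact: routes_meeting_le_crossings.
Qed.

End Feasible.

End Solutions.

(** * Injectivity up to reordering and reversal *)

Section Injectivity.
Local Open Scope ring_scope.
Variables (R : realType) (n m : nat) (I : hvrp R n m).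
Implicit Types (s t : solution n m).

(** The candidate is the route of [t] through the first customer of [h]. The y values there give
    equal types, and the x values give equal edge counts at all shared customers. *)
Lemma matching_route s t h :
  robust_feasible I s -> robust_feasible I t -> to_point I s = to_point I t ->
  h \in s ->
  exists h', [/\ h' \in t, h'.2 = h.2 & h'.1 = h.1 \/ h'.1 = rev h.1].
Proof.
case: h => [[|i r] k] fs ft eq_st sh;
  have [//= r0 uniq_r sub_r] := rf_route fs sh.
have [[r' k'] [th' ir' _]] := route_of ft i; rewrite /= in ir'.
have [/= _ uniq_r' sub_r'] := rf_route ft th'.
have eq_k : k' = k.
  have := to_point_y_route fs k sh (mem_head _ _).
  rewrite eq_st (to_point_y_route ft k th' ir') eqxx.
  by case: eqP => // _ /eqP; rewrite eq_sym oner_eq0.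
exists (r', k'); split=> //.
apply: routes_eq uniq_r uniq_r' ir' _ => j e jr jr' je.
(* The point only has coordinates for edges of the graph; any other set occurs on neither route. *)
have [Ee|ENe] := boolP (e \in edges I).
  have := to_point_x s (exist _ e Ee) k; rewrite eq_st to_point_x.
  rewrite (traversals_route fs k sh jr je) (traversals_route ft k th' jr' je).
  by rewrite eq_k !eqxx => /eqP; rewrite eqr_nat => /eqP.
have /count_memPn -> : e \notin route_edges (i :: r).
  by apply: contra ENe; exact: sub_r.
suff /count_memPn -> : e \notin route_edges r' by [].
by apply: contra ENe; exact: sub_r'.
Qed.

Lemma route_has_customer s h :
  robust_feasible I s -> h \in s -> exists i, i \in h.1.
Proof.
move=> fs /(rf_route fs)[]; case: h.1 => // i r _ _ _.
by exists i; exact: mem_head.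
Qed.

(** Routes are nonempty, so a repeated pair would visit some customer twice. *)
Lemma solution_uniq s : robust_feasible I s -> uniq s.
Proof.
move=> fs; apply: count_mem_uniq => h.
have [sh|/count_memPn //] := boolP (h \in s).
have [i ih] := route_has_customer fs sh.
have le1 : (count_mem h s <= 1)%N.
  by rewrite -(rf_partition fs i); apply: sub_count => h' /eqP ->.
have : (0 < count_mem h s)%N by rewrite -has_count has_pred1.
by case: count le1 => [|[|]].
Qed.

Lemma to_point_inj s t :
  robust_feasible I s -> robust_feasible I t ->
  to_point I s = to_point I t -> same_solution s t.
Proof.
move=> fs ft eq_st.
(* [g] orients each pair of [t] as in [s], so that [map g t] is the reordering of [s] sought. It
   keeps the customers of a pair, and pairs of one solution that share a customer are equal; hence
   it is a bijection. *)
pose g (h : seq 'I_n * 'I_m) := if h \in s then h else (rev h.1, h.2).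
have mem_g h i : (i \in (g h).1) = (i \in h.1).
  by rewrite /g; case: ifP => //=; rewrite mem_rev.
have sg h : h \in t -> g h \in s.
  move=> th.
  have [[r k] [sh /= eq_k eq_r]] := matching_route ft fs (esym eq_st) th.
  rewrite /g; case: ifPn => //.
  by case: h th eq_k eq_r => r' k' th /= <- [] <- //; rewrite sh.
exists (map g t).
  apply: uniq_perm; first exact: solution_uniq.
    rewrite map_inj_in_uniq; first exact: solution_uniq ft.
    move=> h h' th th' eq_g; have [i ih] := route_has_customer ft th.
    by apply: (route_unique ft th th' ih); rewrite -mem_g -eq_g mem_g.
  move=> h; apply/idP/mapP => [sh|[h' th' ->]]; last exact: sg.
  have [h' [th' _ eq_h]] := matching_route fs ft eq_st sh; exists h' => //.
  have [i ih] := route_has_customer fs sh.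
  apply: (route_unique fs sh (sg h' th') ih); rewrite mem_g.
  by case: eq_h => ->; rewrite ?mem_rev.
elim: {fs ft eq_st sg} t => //= h t ->; rewrite andbT /g.
by case: ifP => _ /=; rewrite ?revK !eqxx ?orbT.
Qed.

Lemma same_solution_to_point s t :
  same_solution s t -> to_point I s = to_point I t.
Proof.
case=> u perm_su eq_ut; transitivity (to_point I u).
  congr pair; apply/ffunP => -[e k]; rewrite !ffunE /=.
    by rewrite (perm_big _ perm_su).
  by rewrite (perm_has _ perm_su).
congr pair; apply/ffunP => -[e k]; rewrite !ffunE /=; congr _%:R.
  elim: u t eq_ut {perm_su} => [|[r j] u IHu] [|[r' j'] t] //=.
  move=> /andP[/andP[/eqP /= -> eq_r] /IHu eq_ut]; rewrite !big_cons /= eq_ut.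
  case: ifP => // _; congr (_ + _)%N.
  by case/orP: eq_r => /eqP -> //; rewrite (permP (route_edges_rev r)).
congr nat_of_bool.
elim: u t eq_ut {perm_su} => [|[r j] u IHu] [|[r' j'] t] //=.
move=> /andP[/andP[/eqP /= -> eq_r] /IHu ->].
by case/orP: eq_r => /eqP -> //; rewrite mem_rev.
Qed.

End Injectivity.

(** * From feasible integer points back to solutions *)

Section Surjectivity.
Local Open Scope ring_scope.
Variables (R : realType) (n m : nat) (I : hvrp R n m).
(** Customers with zero demand in every scenario could form a cycle avoiding the depot, since the
    capacity cut of such a set has right-hand side 0. *)
Hypothesis positive_demand :
  forall i : 'I_n, exists2 q, demands I q & 0 < q 0 i.
Variables (p : ip_point I) (fp : ip_constraints p).
Implicit Types (S : {set 'I_n}) (A : {set 'I_n.+1}).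

Definition assigned k : {set 'I_n} := [set i | p.2 (i, k) == 1]%SET.

(** x is real-valued but only takes the values 0, 1 and 2; the two tests recover the natural number,
    and non-edges get 0, as [route_decomposition] requires. *)
Definition multiplicity k (A : {set 'I_n.+1}) : nat :=
  if insub A : option (edge I) is Some e then
    ((p.1 (e, k) == 1%R) + 2 * (p.1 (e, k) == 2%R))%N
  else 0%N.

Lemma assignedE i k : p.2 (i, k) = (i \in assigned k)%:R.
Proof.
rewrite inE; have := ip_y_binary fp i k; rewrite !inE => /orP[]/eqP->.
  by rewrite eq_sym oner_eq0.
by rewrite eqxx.
Qed.

Lemma multiplicityE e k : p.1 (e, k) = (multiplicity k (val e))%:R.
Proof.
rewrite /multiplicity valK.
have : p.1 (e, k) \in [:: 0; 1; 2].
  have [e0|eN0] := boolP (depot \in val e); first exact: (ip_x_depot fp).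
  by have := ip_x_customer fp k eN0; rewrite !inE => /orP[]->; rewrite ?orbT.
rewrite !inE => /or3P[] /eqP ->; rewrite ?eqxx.
- by rewrite -[0]/(0%:R) -[1]/(1%:R) !eqr_nat.
- by rewrite -[1]/(1%:R) !eqr_nat.
- by rewrite -[1]/(1%:R) !eqr_nat.
Qed.

Lemma multiplicity_edge A k : A \notin edges I -> multiplicity k A = 0%N.
Proof. by move=> ENA; rewrite /multiplicity insubN. Qed.

Lemma sum_multiplicity (P : pred {set 'I_n.+1}) k :
  (\sum_(A | P A) multiplicity k A)%N%:R
  = \sum_(e : edge I | P (val e)) p.1 (e, k).
Proof.
rewrite (eq_bigr _ (fun e _ => multiplicityE e k)) -natr_sum; congr _%:R.
by apply: sum_edge => A; exact: multiplicity_edge.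
Qed.

Lemma multiplicity_card k A : (0 < multiplicity k A)%N -> #|A| = 2%N.
Proof.
have [EA _|/multiplicity_edge ->//] := boolP (A \in edges I).
exact: edges_pair EA.
Qed.

Lemma multiplicity_degree k i :
  (\sum_(A : {set 'I_n.+1} | node i \in A) multiplicity k A
   = 2 * (i \in assigned k))%N.
Proof.
apply/eqP; rewrite -(eqr_nat R) (sum_multiplicity (fun A => node i \in A)).
by rewrite (ip_degree fp) assignedE natrM.
Qed.

(** The two sums of the assignment constraint agree, so the nonnegative y over types that do not fit
    sum to 0 and all vanish. *)
Lemma assigned_fit k : assigned k \subset cust_fit I k.
Proof.
apply/fintype.subsetP => i ik; apply: contraLR ik => iNk; rewrite inE.
have [sum_all sum_fit] := ip_assign fp i.
have : \sum_(j | i \notin cust_fit I j) p.2 (i, j) = 0.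
  apply: (addrI (\sum_(j | i \in cust_fit I j) p.2 (i, j))).
  by rewrite addr0 -[RHS]sum_all [RHS](bigID (fun j => i \in cust_fit I j)).
move/psumr_eq0P => -> //; first by rewrite eq_sym oner_eq0.
by move=> j _; rewrite assignedE ler0n.
Qed.

(** On [assigned k] all y are 1, so the correction term of the capacity cut disappears. *)
Lemma assigned_capacity k S : S \subset assigned k ->
  2 * (Num.ceil ((capacity I k)^-1
         * max_demand I (fun q => \sum_(i in S) q 0 i)))%:~R
  <= (\sum_(A | crosses I k S A) multiplicity k A)%N%:R :> R.
Proof.
move=> Sk; have := ip_capacity fp (fintype.subset_trans Sk (assigned_fit k)).
rewrite [X in _ + 2 * X]big1 => [|i /(fintype.subsetP Sk) ik]; last first.
  by rewrite assignedE ik subrr.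
by rewrite mulr0 addr0 (eq_bigl _ _ (mem_cut k S)) -sum_multiplicity.
Qed.

(** The total demand of [S] is positive in some scenario, so the ceiling is positive and some edge
    of the cut has nonzero multiplicity. This is the cut condition of [route_decomposition]. *)
Lemma assigned_cut k S : S \subset assigned k -> S != finset.set0 ->
  exists u v, [/\ u \in node @: S, v \notin node @: S
                & (0 < multiplicity k [set u; v])%N].
Proof.
move=> Sk /set0Pn[i Si].
have [q Iq qi_gt0] := positive_demand i.
have demand_gt0 : 0 < max_demand I (fun q => \sum_(i in S) q 0 i).
  apply: lt_le_trans (le_max_demand (@demand_sum_continuous R n S) Iq).
  rewrite (bigD1 i) //= ltr_pwDl //.
  by apply: sumr_ge0 => j _; exact: demands_ge0 Iq j.
have : (0 < \sum_(A | crosses I k S A) multiplicity k A)%N.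
  rewrite -(ltr_nat R); apply: lt_le_trans (assigned_capacity Sk).
  rewrite mulr_gt0 // ltr0z ceil_gt0 mulr_gt0 // invr_gt0.
  exact: capacity_gt0.
rewrite lt0n sum_nat_eq0 => /forall_inPn[A /crossesP[j [v [Sj vNS _ ->]]]].
rewrite -lt0n => mult_gt0.
by exists (node j), v; split=> //; exact: imset_f.
Qed.

(** * Joining the routes of all types into one solution *)

Section Assembly.
Variable rs : 'I_m -> seq (seq 'I_n).
Hypothesis rs_routes : forall k, all (fun r => (r != [::]) && uniq r) (rs k).
Hypothesis rs_edges : forall k A,
  multiplicity k A = (\sum_(r <- rs k) count_mem A (route_edges r))%N.

Definition assembly : solution n m :=
  [seq (r, k) | k <- enum 'I_m, r <- rs k].

Lemma mem_assembly h : (h \in assembly) = (h.1 \in rs h.2).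
Proof.
apply/allpairsPdep/idP => [[k [r [_ rk ->]]] //|hs].
by exists h.2, h.1; rewrite mem_enum; case: h hs.
Qed.

Lemma sum_assembly (F : seq 'I_n * 'I_m -> nat) :
  (\sum_(h <- assembly) F h = \sum_k \sum_(r <- rs k) F (r, k))%N.
Proof. by rewrite big_allpairs_dep big_enum. Qed.

Lemma sum_assembly_type (F : seq 'I_n -> nat) k :
  (\sum_(h <- assembly | h.2 == k) F h.1 = \sum_(r <- rs k) F r)%N.
Proof.
rewrite big_mkcond sum_assembly (bigD1 k) //= eqxx.
rewrite [X in (_ + X)%N]big1 ?addn0 //.
by move=> j /negPf neq_jk; rewrite big1 // => r _; rewrite neq_jk.
Qed.

Lemma routeP k r : r \in rs k -> r != [::] /\ uniq r.
Proof. by move/(allP (rs_routes k))/andP. Qed.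

Lemma sum_multiplicity_routes (P : pred {set 'I_n.+1}) k :
  (\sum_(A | P A) multiplicity k A
   = \sum_(r <- rs k) count P (route_edges r))%N.
Proof.
rewrite (eq_bigr _ (fun A _ => rs_edges k A)) exchange_big /=.
by apply: eq_bigr => r _; rewrite sum_count_memT.
Qed.

(** Each route through [i] contributes 2 to the degree of [i], which is 2 or 0 according to
    [assigned]. *)
Lemma count_routes i k : count (fun r => i \in r) (rs k) = (i \in assigned k).
Proof.
apply/eqP; rewrite -(eqn_pmul2l (ltn0Sn 1)) -multiplicity_degree.
rewrite (sum_multiplicity_routes (fun A => node i \in A)) -sum1_count.
rewrite big_mkcond big_distrr /=; apply/eqP; apply: eq_big_seq => r rk.
by have [r0 uniq_r] := routeP rk; rewrite route_degree //; case: (i \in r).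
Qed.

Lemma route_assigned k r : r \in rs k -> [set i in r]%SET \subset assigned k.
Proof.
move=> rk; apply/fintype.subsetP => i; rewrite [i \in finset _]inE => ir.
by rewrite -[i \in _]lt0b -count_routes -has_count; apply/hasP; exists r.
Qed.

Lemma route_load k r q : r \in rs k -> demands I q ->
  \sum_(i in r) q 0 i <= capacity I k.
Proof.
move=> rk Iq; have [r0 uniq_r] := routeP rk; set S := [set i in r]%SET.
(* A crossing edge contains a customer of [r], so among [rs k] only [r] uses it. Its other end is on
   [r] but outside [S], hence is the depot, and [r] has just two edge occurrences there. *)
have cut_le2 : (\sum_(A | crosses I k S A) multiplicity k A <= 2)%N.
  rewrite -(depot_degree r0 uniq_r).
  rewrite (eq_bigr (fun A => count_mem A (route_edges r))) => [|A]; last first.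
    case/crossesP=> i [v [Si _ _ A_iv]]; rewrite inE in Si.
    have iA : node i \in A by rewrite A_iv set21.
    have ik : count (fun r => i \in r) (rs k) = 1%N.
      rewrite count_routes; have /fintype.subsetP -> // := route_assigned rk.
      by rewrite inE.
    rewrite rs_edges (sum_single ik rk) // => r' ir'.
    exact: count_route_edges0 iA ir'.
  rewrite sum_count_memT -!size_filter -!sum1_size !big_filter.
  rewrite [leqRHS]big_mkcond [leqLHS]big_mkcond /=.
  apply: leq_sum_seq => A rA _; case: ifP => // /crossesP[i [v [_ vNS _ A_iv]]].
  have [v0|[j v_j]] := node_or_depot v; first by rewrite A_iv v0 set22.
  case/negP: vNS; rewrite v_j imset_f // inE -mem_route_nodes.
  by apply: (route_edges_sub rA); rewrite A_iv v_j set22.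
have : Num.ceil ((capacity I k)^-1
    * max_demand I (fun q => \sum_(i in S) q 0 i)) <= 1.
  have := assigned_capacity (route_assigned rk); rewrite -/S => le_cut.
  have := le_trans le_cut (_ : _ <= 2 * 1%:~R); rewrite ler_pM2l // ler_int.
  by apply; rewrite mulr1 ler_nat.
rewrite ceil_le_int ler_pdivrMl ?capacity_gt0 // mulr1; apply: le_trans.
have := le_max_demand (@demand_sum_continuous R n S) Iq.
by rewrite (eq_bigl [in r]) // => i; rewrite inE.
Qed.

Lemma assembly_feasible : robust_feasible I assembly.
Proof.
split=> [[r k]|i|k|[r k] q]; rewrite ?mem_assembly /=.
- move=> rk; have [r0 uniq_r] := routeP rk; split=> // A rA.
  (* An edge used by some route has positive multiplicity, hence belongs to the graph. *)
  apply: contraLR (rA) => /(multiplicity_edge k)/eqP.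
  rewrite rs_edges sum_nat_seq_eq0 => /allP/(_ r rk) /= /eqP.
  by move/count_memPn.
- rewrite -sum1_count big_mkcond sum_assembly /=.
  apply/eqP; rewrite -(eqr_nat R) natr_sum; apply/eqP.
  have [sum_all sum_fit] := ip_assign fp i.
  rewrite -[RHS]sum_fit -sum_all; apply: eq_bigr => k _.
  by rewrite -big_mkcond sum1_count count_routes assignedE.
- rewrite -sum1_count (sum_assembly_type (fun=> 1%N)) sum1_size.
  (* The fleet bound is doubled, since each route meets the depot with two edges. *)
  rewrite -(leq_pmul2l (ltn0Sn 1)) -(ler_nat R) [leRHS]natrM.
  apply: le_trans (ip_fleet fp k).
  rewrite -(sum_multiplicity (fun A => depot \in A)).
  rewrite ler_nat (sum_multiplicity_routes (fun A => depot \in A)).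
  rewrite -sum1_size big_distrr /=; apply: leq_sum_seq => r rk _.
  by have [r0 uniq_r] := routeP rk; rewrite depot_degree.
- by move=> rk Iq; exact: route_load.
Qed.

Lemma assembly_to_point : to_point I assembly = p.
Proof.
rewrite [RHS]surjective_pairing.
congr pair; apply/ffunP => -[e k]; rewrite !ffunE /=.
  rewrite (sum_assembly_type (fun r => count_mem (val e) (route_edges r))).
  by rewrite -rs_edges -multiplicityE.
rewrite assignedE; congr ((nat_of_bool _)%:R).
rewrite -[RHS]lt0b -count_routes -has_count.
apply/hasP/hasP => [[[r j]]|[r rk er]].
  by rewrite mem_assembly /= => rj /andP[er /eqP <-]; exists r.
by exists (r, k); rewrite ?mem_assembly //= er eqxx.
Qed.

End Assembly.

End Surjectivity.

Local Open Scope ring_scope.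

Theorem proposition3 (R : realType) (n m : nat) (I : hvrp R n m)
    (positive_demand : forall i : 'I_n, exists2 q, demands I q & 0 < q 0 i) :
  [/\ forall s : solution n m,
        robust_feasible I s -> feasible (hvrp_ip I) (to_point I s),
      forall s t : solution n m,
        robust_feasible I s -> robust_feasible I t ->
        (to_point I s = to_point I t <-> same_solution s t)
    & forall p : ip_point I, feasible (hvrp_ip I) p ->
        exists2 s : solution n m, robust_feasible I s & to_point I s = p].
Proof.
split=> [s fs|s t fs ft|p fp]; first exact: to_point_feasible.
  by split; [exact: to_point_inj|exact: same_solution_to_point].
(* Each type is decomposed separately; choice collects the decompositions into one function of the
   type. *)
have /choice[rs rs_ok] : forall k, exists rs : seq (seq 'I_n),
    all (fun r => (r != [::]) && uniq r) rs /\
    forall A, multiplicity p k A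
              = (\sum_(r <- rs) count_mem A (route_edges r))%N.
  move=> k; have [] := @route_decomposition n (multiplicity p k) (assigned p k).
  - by move=> A; exact: multiplicity_card.
  - by move=> i; exact: multiplicity_degree.
  - by move=> S; exact: assigned_cut.
  - by move=> rs rs_routes rs_edges; exists rs.
pose rs_routes k := (rs_ok k).1; pose rs_edges k := (rs_ok k).2.
exists (assembly rs).
  exact: (assembly_feasible fp rs_routes rs_edges).
exact: (assembly_to_point fp rs_routes rs_edges).
Qed.
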